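(* If $k\ge 4$, the multiset $\{n_1,\dots,n_{k-1}\}$ of positive integers is representable, and $n_k\in\{1,2,3\}$, then $\{n_1,\dots,n_{k-1},n_k\}$ is representable.
   Context: All point sets are finite subsets of the Euclidean plane. A point $x$ blocks two points $v$ and $w$ if $x$ is in the interior of the line segment $\overline{vw}$. Two points $v,w$ are visible with respect to a point set $P$ if no point in $P$ blocks $v$ and $w$. A point set $P$ is $k$-blocked if each point in $P$ is assigned one of $k$ colours such that each pair of distinct points $v,w\in P$ are visible with respect to $P$ if and only if $v$ and $w$ are coloured differently. For a multiset $\{n_1,\dots,n_k\}$ of $k$ positive integers, $P$ is $\{n_1,\dots,n_k\}$-blocked if it is $k$-blocked and for some labelling of the colours by $1,\dots,k$, the $i$-th colour class has exactly $n_i$ points for each $i$. The multiset $\{n_1,\dots,n_k\}$ is representable if there is an $\{n_1,\dots,n_k\}$-blocked point set. *)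

(* Defs.v *)
From mathcomp Require Export all_boot all_order all_algebra all_fingroup.
From mathcomp Require Export finmap multiset reals.

Set Implicit Arguments.
Unset Strict Implicit.
Unset Printing Implicit Defensive.

Import Order.TTheory GRing.Theory Num.Theory.

Local Open Scope ring_scope.

Notation plane R := 'rV[R]_2.

Section BlockedPointSets.

Variable R : realType.

Definition blocks (x v w : plane R) : Prop :=
  exists2 t : R, 0 < t < 1 & x = (1 - t) *: v + t *: w.

Definition visible (P : {fset plane R}) (v w : plane R) : Prop :=
  ~ exists2 x : plane R, x \in P & blocks x v w.

(* Here and below, [P] used as a type is the finite type of its points. *)
Definition blocking_colouring (P : {fset plane R}) (k : nat) (c : P -> 'I_k)
    : Prop :=
  forall v w : P, v != w -> (visible P (val v) (val w) <-> c v != c w).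

Definition colour_class (P : {fset plane R}) (k : nat) (c : P -> 'I_k)
    (i : 'I_k) : {set P} :=
  [set v | c v == i].

(* A multiset of naturals coerces to the list n_1, ..., n_k of its elements
   with multiplicity, so [size M] is k; [lab] sends the index of an entry of
   this list to a colour, hence the order of the list is irrelevant. *)
Definition multiset_blocked (M : {mset nat}%mset) (P : {fset plane R}) : Prop :=
  exists2 c : P -> 'I_(size M), blocking_colouring c
    & exists lab : {perm 'I_(size M)},
        forall i : 'I_(size M), #|colour_class c (lab i)| = nth 0%N M i.

Definition representable (M : {mset nat}%mset) : Prop :=
  exists P : {fset plane R}, multiset_blocked M P.

End BlockedPointSets.

(* Main.v *)
Require Import Defs.
From mathcomp Require Import ring lra.

(** Three points x, y, z of P with pairwise distinct colours are not collinear,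
    since otherwise one of them would block the other two. A triangle u, v, w
    with z, x, y in the interiors of uv, vw, uw moves in a family of positive
    dimension, and a generic member has all three vertices off every line
    through two points of P. Any nonempty subset of {u, v, w} can then be
    added to P as a new colour class. *)

Set Implicit Arguments.
Unset Strict Implicit.
Unset Printing Implicit Defensive.

Import Order.TTheory GRing.Theory Num.Theory.
Local Open Scope fset_scope.
Local Open Scope ring_scope.

(** Trades the labelling permutation for [perm_eq] and frees the number [n] of colours from
    [size M], so that a colouring by ['I_n.+1] needs no cast to the size of the enlarged
    multiset. *)
Lemma multiset_blocked_perm_eq (R : realType) (M : {mset nat}%mset)
    (P : {fset plane R}) :
  multiset_blocked M P <->
  exists n (c : P -> 'I_n), blocking_colouring c /\
    perm_eq [seq #|colour_class c i| | i : 'I_n] M.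
Proof.
split=> [[c cP [lab labP]]|[n [c [cP]]]].
  exists (size M), c; split=> //; rewrite perm_sym.
  apply/(@tuple_permP _ _ _ [tuple #|colour_class c i| | i < size M]).
  exists lab; apply: (@eq_from_nth _ 0%N) => [|i iM].
    by rewrite size_tuple.
  transitivity (nth 0%N M (Ordinal iM)); first by [].
  by rewrite -labP -[i]/(val (Ordinal iM)) -tnth_nth !tnth_mktuple.
move=> /[dup] /perm_size; rewrite size_map size_enum_ord => def_n.
subst n; rewrite perm_sym => /(@tuple_permP _ _ _
  [tuple #|colour_class c i| | i < size M])[lab labP].
exists c => //; exists lab => i.
have := congr1 (fun s => nth 0%N s i) labP.
by rewrite -tnth_nth !tnth_mktuple => <-.
Qed.

(** The [size p] distinct reciprocals 1/2, 1/3, ... outnumber the degree of [p], so they cannot all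
    be roots. *)
Lemma exists_unit_itv_nonroot (F : numFieldType) (p : {poly F}) :
  p != 0 -> exists2 t : F, 0 < t < 1 & ~~ root p t.
Proof.
move=> p0; pose s : seq F := [seq i.+2%:R^-1 | i <- iota 0 (size p)].
have [/(max_poly_roots p0)|] := boolP (all (root p) s).
  rewrite size_map size_iota ltnn => /(_ _)/notF[].
  rewrite map_inj_uniq ?iota_uniq//.
  by move=> i j /invr_inj/eqP; rewrite eqr_nat => /eqP[].
case/allPn=> _ /mapP[i _ ->] pi0; exists i.+2%:R^-1 => //.
by rewrite invr_gt0 ltr0n invf_lt1 ?ltr0n// ltr1n.
Qed.

(** * Orientation determinants, collinearity and betweenness *)

Section Orientation.

Variable R : realType.
Implicit Types (p q x y z u v w : plane R) (s t : R).

(** Twice the signed area of the triangle [p], [q], [x]. *)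
Definition orient p q x : R :=
  (q 0 0 - p 0 0) * (x 0 1 - p 0 1) - (q 0 1 - p 0 1) * (x 0 0 - p 0 0).

Lemma plane_eqP x y : x 0 0 = y 0 0 -> x 0 1 = y 0 1 -> x = y.
Proof.
move=> e0 e1; apply/rowP=> i.
have [->|->] // : i = 0 \/ i = 1.
by case: i => -[|[|]]// ?; [left|right]; apply: val_inj.
Qed.

Lemma orient_line p q s : orient p q ((1 - s) *: p + s *: q) = 0.
Proof. by rewrite /orient !mxE; ring. Qed.

(** The function [orient p q] is affine, so it commutes with weighted means, even with negative
    weights. *)
Lemma orient_barycenter p q x y z (a b c : R) : a + b + c != 0 ->
  orient p q ((a + b + c)^-1 *: (a *: x + b *: y + c *: z)) =
  (a + b + c)^-1 * (a * orient p q x + b * orient p q y + c * orient p q z).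
Proof. by move=> s0; rewrite /orient !mxE; field. Qed.

Lemma orient_eq0_line p q x : p != q -> orient p q x = 0 ->
  exists s, x = (1 - s) *: p + s *: q.
Proof.
rewrite /orient => pq e; have [e0|n0] := eqVneq (q 0 0) (p 0 0).
  have n1 : q 0 1 - p 0 1 != 0.
    by rewrite subr_eq0; apply: contra pq => /eqP e1; apply/eqP/plane_eqP.
  have x0 : x 0 0 = p 0 0.
    move/eqP: e; rewrite e0 subrr mul0r sub0r oppr_eq0 mulf_eq0 (negPf n1)/=.
    by rewrite subr_eq0 => /eqP.
  exists ((x 0 1 - p 0 1) / (q 0 1 - p 0 1)).
  by apply: plane_eqP; rewrite !mxE ?x0 ?e0; field.
rewrite -subr_eq0 in n0.
exists ((x 0 0 - p 0 0) / (q 0 0 - p 0 0)).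
apply: plane_eqP; rewrite !mxE; first by field.
have -> : x 0 1 = p 0 1 + (q 0 1 - p 0 1) * (x 0 0 - p 0 0) / (q 0 0 - p 0 0).
  by apply: (mulfI n0); rewrite mulrDr [in RHS]mulrCA divff// mulr1; lra.
by field.
Qed.

Lemma noncollinear_off_line p q x y z : p != q -> orient x y z != 0 ->
  [\/ orient p q x != 0, orient p q y != 0 | orient p q z != 0].
Proof.
move=> pq.
have [/(orient_eq0_line pq)[a ->]|] := eqVneq (orient p q x) 0;
  last by constructor 1.
have [/(orient_eq0_line pq)[b ->]|] := eqVneq (orient p q y) 0;
  last by constructor 2.
have [/(orient_eq0_line pq)[c ->]|] := eqVneq (orient p q z) 0;
  last by constructor 3.
by case/eqP; rewrite /orient !mxE; ring.
Qed.

Lemma blocks_sym x v w : blocks x v w -> blocks x w v.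
Proof.
case=> t /andP[t0 t1] ->; exists (1 - t); first by apply/andP; split; lra.
by rewrite opprB addrC subrKC.
Qed.

Lemma collinear_blocks x y z : x != y -> y != z -> z != x ->
  orient x y z = 0 -> [\/ blocks x y z, blocks y z x | blocks z x y].
Proof.
move=> xy yz zx /(orient_eq0_line xy)[s def_z].
have s0 : s != 0.
  by apply: contraNneq zx => s0; rewrite def_z s0 subr0 scale1r scale0r addr0.
have s1 : s != 1.
  by apply: contraNneq yz => s1; rewrite def_z s1 subrr scale1r scale0r add0r.
(* The place of [s] relative to 0 and 1 tells which point is the middle one; solving the equation
   [def_z] for that point gives the parameter. *)
have [s_lt0|s_gt0|/eqP] := ltgtP s 0; last by rewrite (negPf s0).
- have d_gt0 : 0 < 1 - s by lra.
  constructor 1; exists (1 - s)^-1.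
    by rewrite invr_gt0 d_gt0 invf_lt1//; lra.
  by apply: plane_eqP; rewrite def_z !mxE; field; rewrite gt_eqF.
- have [s_lt1|s_gt1|/eqP] := ltgtP s 1; last by rewrite (negPf s1).
    by constructor 3; exists s => //; rewrite s_gt0.
  constructor 2; exists (1 - s^-1).
    have := invr_gt0 s; rewrite s_gt0 => si_gt0.
    by have := invf_lt1 s_gt0; rewrite s_gt1 => si_lt1; apply/andP; split; lra.
  by apply: plane_eqP; rewrite def_z !mxE; field.
Qed.

End Orientation.

(** * Adding a colour class, and the generic triangle that supplies it *)

Section Extension.

Variable R : realType.
Implicit Types (P Q : {fset plane R}) (p q x y z u v w : plane R).

Lemma visible_sym P v w : visible P v w -> visible P w v.
Proof. by move=> vP [x xP /blocks_sym xb]; apply: vP; exists x. Qed.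

Lemma orient_blocks x v w : blocks x v w -> orient v w x = 0.
Proof. by case=> t _ ->; apply: orient_line. Qed.

Lemma orient_rot x y z : orient x y z = orient y z x.
Proof. by rewrite /orient; ring. Qed.

Lemma blocks_neq x v w : v != w -> blocks x v w -> x != v.
Proof.
move=> vw [t /andP[t0 _] ->]; apply: contra vw => /eqP e.
have : t *: (w - v) = (1 - t) *: v + t *: w - v.
  by apply: plane_eqP; rewrite !mxE; ring.
by rewrite e subrr => /eqP; rewrite scaler_eq0 gt_eqF//= subr_eq0 eq_sym.
Qed.

Lemma blocks_trans x y v w : blocks x v w -> blocks y x w -> blocks y v w.
Proof.
case=> t /andP[t0 t1] -> [s /andP[s0 s1] ->].
exists (1 - (1 - s) * (1 - t)); first by apply/andP; split; nra.
by apply: plane_eqP; rewrite !mxE; ring.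
Qed.

Definition off_lines P q :=
  {in P &, forall p p', p != p' -> orient p p' q != 0}.

(** Points of [Q] lie on no line spanned by [P], so they block no pair in [P] and see all of [P],
    while pairs in [Q] are blocked by [P]. Hence [Q] can take the new colour [ord0], with the old
    colours shifted by [lift ord0]. *)
Lemma blocking_colouring_extension n P Q (c : P -> 'I_n) :
  blocking_colouring c -> [disjoint P & Q] -> {in Q, forall q, off_lines P q} ->
  {in Q &, forall q q', q != q' -> exists2 p, p \in P & blocks p q q'} ->
  exists d : P `|` Q -> 'I_n.+1, [/\ blocking_colouring d,
    #|colour_class d ord0| = #|` Q| &
    forall i, #|colour_class d (lift ord0 i)| = #|colour_class c i|].
Proof.
move=> cP PQ offQ blocksQ.
pose d (v : P `|` Q) : 'I_n.+1 :=
  if insub (val v) : option P is Some p then lift ord0 (c p) else ord0.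
have inPQ v w : v \in P -> w \in Q -> v != w.
  by move=> vP; apply: contraTneq => <-; apply: (fdisjointP PQ).
have dP (v : P `|` Q) (p : P) : val v = val p -> d v = lift ord0 (c p).
  by move=> e; rewrite /d e valK.
have dQ (v : P `|` Q) : val v \in Q -> d v = ord0.
  by move=> vQ; rewrite /d insubN//; apply: contraL vQ => /(fdisjointP PQ).
have dPQ (v : P `|` Q) : (exists2 p : P, val v = val p & d v = lift ord0 (c p))
    \/ (val v \in Q /\ d v = ord0).
  have := valP v; rewrite in_fsetU => /orP[vP|vQ]; last by right; rewrite dQ.
  by left; exists [` vP]; rewrite ?(dP _ [` vP]).
have visPP p p' : p \in P -> p' \in P -> p != p' ->
    visible (P `|` Q) p p' <-> visible P p p'.
  move=> pP p'P pp'; split=> vis [x xP xb]; apply: vis.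
    by exists x => //; rewrite in_fsetU xP.
  exists x => //; move: xP; rewrite in_fsetU => /orP[//|xQ].
  by have := offQ _ xQ _ _ pP p'P pp'; rewrite orient_blocks// eqxx.
have visPQ p q : p \in P -> q \in Q -> visible (P `|` Q) p q.
  move=> pP qQ; have pq := inPQ _ _ pP qQ.
  suff visP : visible P p q.
    move=> [x]; rewrite in_fsetU => /orP[xP|xQ] xb.
      by apply: visP; exists x.
    have xq : x != q.
      by apply: (@blocks_neq x q p); [rewrite eq_sym|apply: blocks_sym].
    (* A blocker [x] in [Q] is itself separated from [q] by a point of [P], which then blocks [p]
       and [q] too. *)
    have [p' p'P p'b] := blocksQ _ _ xQ qQ xq.
    by apply: visP; exists p' => //; apply: blocks_trans p'b.
  (* A blocker [x] in [P] would put [q] on the line through [x] and [p]. *)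
  move=> [x xP xb]; have xp := blocks_neq pq xb.
  have := offQ _ qQ _ _ xP pP xp.
  by rewrite -2!orient_rot orient_blocks// eqxx.
have n0 i : lift ord0 i != ord0 :> 'I_n.+1 by rewrite eq_sym neq_lift.
exists d; split.
- move=> v w vw; have vw' : val v != val w by [].
  case: (dPQ v) (dPQ w) => [[p ep ->]|[vQ ->]] [[p' ep' ->]|[wQ ->]].
  + rewrite ep ep' in vw' *; rewrite visPP ?fsvalP//.
    by rewrite (inj_eq lift_inj); apply: cP.
  + by rewrite n0 ep; split=> // _; apply: visPQ; rewrite ?fsvalP.
  + rewrite eq_sym n0 ep'; split=> // _.
    by apply/visible_sym/visPQ; rewrite ?fsvalP.
  + rewrite eqxx; split=> // vis; have [x xP xb] := blocksQ _ _ vQ wQ vw'.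
    by case: vis; exists x => //; rewrite in_fsetU xP.
- rewrite cardfE -cardsT -(card_imset _ (fincl_inj (AsubB := fsubsetUr P Q))).
  apply: eq_card => v; rewrite inE; apply/eqP/imsetP => [dv|[q _ ->]].
    case: (dPQ v) => [[p _]|[vQ _]].
      by rewrite dv => /esym/eqP; rewrite (negPf (n0 _)).
    by exists [` vQ] => //; apply: val_inj.
  by apply: dQ; apply: fsvalP.
- move=> i; rewrite -(card_imset _ (fincl_inj (AsubB := fsubsetUl P Q))).
  apply: eq_card => v; rewrite inE; apply/eqP/imsetP => [dv|[p]].
    case: (dPQ v) => [[p vp]|[_]]; last first.
      by rewrite dv => /eqP; rewrite (negPf (n0 _)).
    rewrite dv => /lift_inj ->; exists p; first by rewrite inE.
    exact: val_inj.
  by rewrite inE => /eqP <- ->; apply: dP.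
Qed.

Lemma exists_blocked_triangle P x y z : orient x y z != 0 ->
  exists u v w, [/\ off_lines P u, off_lines P v & off_lines P w] /\
    [/\ blocks z u v, blocks x v w & blocks y u w].
Proof.
(* The triangle dividing its sides at z = (1 - t) u + t v, x = (1 - t) v + t w
   and y = (u + w) / 2 has vertices whose barycentric coordinates in x, y, z
   are quadratic in t up to a common factor; gu, gv and gw vanish at t when u,
   v and w lie on the line pq. For each vertex the three coordinates are
   linearly independent in t, so none of these polynomials is zero. *)
move=> xyz; have hornE :=
  (hornerD, hornerN, hornerM, hornerC, hornerX, hornerXn, horner_exp).
pose gu p q : {poly R} := (orient p q z)%:P * (1 - 'X)
  - (orient p q x)%:P * 'X + (2 * orient p q y)%:P * 'X^2.
pose gv p q : {poly R} := (orient p q x)%:P * (1 - 'X)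
  - (2 * orient p q y)%:P * ('X - 'X^2) + (orient p q z)%:P * 'X.
pose gw p q : {poly R} := (2 * orient p q y)%:P * (1 - 'X) ^+ 2
  - (orient p q z)%:P * (1 - 'X) + (orient p q x)%:P * 'X.
(* One product over all pairs, so that a single non-root [t] handles every line at once. *)
pose g := \prod_(p <- P) \prod_(q <- P | p != q) (gu p q * gv p q * gw p q).
have g0 : g != 0.
  rewrite prodf_seq_neq0; apply/allP => p _ /=.
  rewrite prodf_seq_neq0; apply/allP => q _; apply/implyP => pq.
  (* Vanishing at 0, 1 and -1 gives three linear equations that force the orientations of [x], [y]
     and [z] to be zero. *)
  have nz (h : {poly R}) : ~ (h.[0] = 0 /\ h.[1] = 0 /\ h.[-1] = 0) -> h != 0.
    by move=> h0; apply/eqP => hE; apply: h0; rewrite hE !horner0.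
  have offxyz : ~ (orient p q x = 0 /\ orient p q y = 0 /\ orient p q z = 0).
    move=> [ex [ey ez]].
    by case: (noncollinear_off_line pq xyz); rewrite ?ex ?ey ?ez eqxx.
  rewrite !mulf_neq0//; apply: nz; rewrite /gu /gv /gw !hornE => -[e0 [e1 e2]];
    by apply: offxyz; repeat split; lra.
have [t t01 gt] := exists_unit_itv_nonroot g0.
have gtP p q : p \in P -> q \in P -> p != q ->
    [/\ (gu p q).[t] != 0, (gv p q).[t] != 0 & (gw p q).[t] != 0].
  move=> pP qP pq; apply/and3P; rewrite andbA -!negb_or -!mulf_eq0.
  move: gt; rewrite /root horner_prod prodf_seq_neq0 => /allP/(_ p pP)/=.
  rewrite horner_prod prodf_seq_neq0 => /allP/(_ q qP); rewrite pq/=.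
  by rewrite !hornerM !mulf_eq0.
have [t0 t1] := andP t01.
pose bary a b c := (a + b + c)^-1 *: (a *: x + b *: y + c *: z).
exists (bary (- t) (2 * t ^+ 2) (1 - t)).
exists (bary (1 - t) (- (2 * t * (1 - t))) t).
exists (bary t (2 * (1 - t) ^+ 2) (- (1 - t))).
(* All three weight sums equal [t ^+ 2 + (1 - t) ^+ 2], which is positive. *)
have du : - t + 2 * t ^+ 2 + (1 - t) != 0 by rewrite gt_eqF//; nra.
have dv : 1 - t + - (2 * t * (1 - t)) + t != 0 by rewrite gt_eqF//; nra.
have dw : t + 2 * (1 - t) ^+ 2 + - (1 - t) != 0 by rewrite gt_eqF//; nra.
split.
  split=> p q pP qP pq; rewrite orient_barycenter// mulf_neq0 ?invr_eq0//;
    have [] := gtP p q pP qP pq; rewrite /gu /gv /gw !hornE => nu nv nw.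
  - by apply: contra nu => /eqP e; apply/eqP; rewrite -e; ring.
  - by apply: contra nv => /eqP e; apply/eqP; rewrite -e; ring.
  - by apply: contra nw => /eqP e; apply/eqP; rewrite -e; ring.
split.
- by exists t => //; apply: plane_eqP; rewrite !mxE; field;
    do ?[apply/andP; split]; rewrite gt_eqF//; nra.
- by exists t => //; apply: plane_eqP; rewrite !mxE; field;
    do ?[apply/andP; split]; rewrite gt_eqF//; nra.
- exists 2^-1; first by apply/andP; split; lra.
  by apply: plane_eqP; rewrite !mxE; field;
    do ?[apply/andP; split]; rewrite gt_eqF//; nra.
Qed.

End Extension.

Local Close Scope ring_scope.
Local Close Scope fset_scope.

Theorem corollary11 (R : realType) (k : nat) (M : {mset nat}%mset) (m : nat) :
  4 <= k ->
  size M = k.-1 ->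
  (forall n : nat, n \in M -> 0 < n) ->
  representable R M ->
  m \in [:: 1; 2; 3] ->
  representable R (m +` M)%mset.
Proof.
move=> k4 sizeM M_gt0 [P /multiset_blocked_perm_eq[n [c [cP cM]]]] m123.
(* The bound on [k] leaves at least three old colours, enough for the triple [x], [y], [z]. *)
have n3 : (2 < n)%N.
  move/perm_size: cM; rewrite size_map size_enum_ord sizeM => ->.
  by rewrite ltn_predRL.
have classP i : exists p : P, c p = i.
  have : 0 < #|colour_class c i|.
    apply: M_gt0; rewrite -(perm_mem cM); apply: map_f; exact: mem_enum.
  by case/card_gt0P=> p; rewrite inE => /eqP; exists p.
pose i0 := Ordinal (ltnW (ltnW n3)).
pose i1 := Ordinal (ltnW n3); pose i2 := Ordinal n3.
have [x cx] := classP i0; have [y cy] := classP i1; have [z cz] := classP i2.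
have nb (p q r : P) : c q != c r -> ~ blocks (val p) (val q) (val r).
  move=> cqr b; have qr : q != r by apply: contraNneq cqr => ->.
  by have [_ /(_ cqr)] := cP _ _ qr; apply; exists (val p); rewrite ?fsvalP.
have neq (p q : P) : c p != c q -> val p != val q.
  by move=> cpq; apply: contraNneq cpq => /val_inj ->.
have xyz : orient (val x) (val y) (val z) != 0%R.
  by apply/eqP => /collinear_blocks[]; rewrite ?neq ?cx ?cy ?cz//; apply: nb;
    rewrite ?cx ?cy ?cz.
have [u [v [w [[offu offv offw] [zuv xvw yuw]]]]] :=
  exists_blocked_triangle P xyz.
have offN q : off_lines P q -> q \notin P.
  move=> offq; apply/negP => qP.
  (* If [q] were in [P], it would lie on the line joining it to another point of [P]: to [x], or to
     [y] when [q] is [x]. *)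
  have [p pP pq] : exists2 p, p \in P & p != q.
    have [e|] := eqVneq (val x) q; last by exists (val x); rewrite ?fsvalP.
    by exists (val y); rewrite ?fsvalP// -e neq// cy cx.
  have := offq _ _ pP qP pq.
  by rewrite -orient_rot /orient => /eqP; apply; ring.
(* A degenerate segment contains only its endpoint, so [p] would be [q]. *)
have neqQ p q q' : p \in P -> q \notin P -> blocks p q q' -> q != q'.
  move=> pP qNP [t _ def_p]; apply: contraNneq qNP => e; move: pP.
  by rewrite def_p -e -scalerDl subrK scale1r.
have uv := neqQ _ _ _ (valP z) (offN _ offu) zuv.
have vw := neqQ _ _ _ (valP x) (offN _ offv) xvw.
have uw := neqQ _ _ _ (valP y) (offN _ offu) yuw.
pose s := take m [:: u; v; w].
have s_uniq : uniq s by rewrite take_uniq//= !inE negb_or uv uw vw.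
pose Q : {fset plane R} := [fset q in s]%fset.
have Qs q : q \in Q -> q \in [:: u; v; w] by rewrite inE/= => /mem_take.
have offQ : {in Q, forall q, off_lines P q}.
  by move=> q /Qs; rewrite !inE => /or3P[]/eqP->.
have cardQ : #|` Q| = m.
  rewrite card_fseq undup_id// size_take.
  by move: m123; rewrite !inE => /or3P[]/eqP->.
have [||d [dP d0 dS]] := @blocking_colouring_extension _ _ _ Q _ cP _ offQ.
- by apply/fdisjointP => p pP; apply: contraL pP => /offQ/offN.
- have [vu wu wv] := And3 (blocks_sym zuv) (blocks_sym yuw) (blocks_sym xvw).
  move=> q q' /Qs + /Qs; rewrite !inE => /or3P[]/eqP-> /or3P[]/eqP->;
    rewrite ?eqxx// => _;
    by [exists (val z); rewrite ?fsvalP|exists (val y); rewrite ?fsvalP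
       |exists (val x); rewrite ?fsvalP].
exists (P `|` Q)%fset; apply/multiset_blocked_perm_eq.
exists n.+1, d; split=> //.
(* Listing [ord0] first turns the class sizes into [m] followed by the old sizes. *)
rewrite /image_mem enum_ordSl/= d0 cardQ -map_comp.
under eq_map => i do rewrite /= dS.
apply: (@perm_trans _ (m :: M)); first by rewrite perm_cons.
by apply/allP => a _; rewrite /= !count_mem_mset mset1DE [a == m]eq_sym.
Qed.
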